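(* Let $s:\mathfrak{C}\to\{0,1\}^n\cup\{*\}$ be a $4$-certificate of the $n$-dimensional hypercube $\mathfrak{C}=\{0,1\}^n$ with no projectable dimensions and such that $P_s$ spans all dimensions. Then $n=3$ and $s$ is isomorphic, up to flipping all the edges in some subset of the dimensions, to one of the partial outmaps $s^{(a)},s^{(b)}$ of $\{0,1\}^3$ given by $$s^{(a)}(100)=101,\quad s^{(a)}(010)=110,\quad s^{(a)}(001)=011,\quad s^{(a)}(111)=000,$$ $$s^{(b)}(000)=010,\quad s^{(b)}(100)=101,\quad s^{(b)}(011)=111,\quad s^{(b)}(111)=000,$$ with value $*$ at all other vertices. That is, there are $r\in\{s^{(a)},s^{(b)}\}$, a permutation $\pi$ of the three coordinates (acting on bitstrings of length $3$), and $a,z\in\{0,1\}^3$ such that for every $u\in\{0,1\}^3$: $s(\pi(u)\oplus a)=\pi(r(u))\oplus z$ if $r(u)\ne *$, and $s(\pi(u)\oplus a)=*$ if $r(u)=*$.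
   Context: The hypercube $\mathfrak{C}=\{0,1\}^n$ has an edge between $u$ and $u\oplus e_i$ for each $u\in\mathfrak{C}$, $i\in[n]=\{1,\dots,n\}$; $\oplus$ is bitwise XOR. A unique sink orientation (USO) is an orientation of the edges such that every face (subcube) has exactly one sink; it is identified with its outmap $t:\mathfrak{C}\to\{0,1\}^n$, where $t(u)_i=1$ iff the edge between $u$ and $u\oplus e_i$ is oriented away from $u$. (Equivalently, $t:\mathfrak{C}\to\{0,1\}^n$ is a USO iff $(t(u)\oplus t(v))\wedge(u\oplus v)\ne0^n$ for all distinct $u,v$.) A partial outmap is a function $s:\mathfrak{C}\to\{0,1\}^n\cup\{*\}$; its set of known vertices is $P_s=\{u\mid s(u)\ne *\}$. It is completable if there is a USO $t$ of $\mathfrak{C}$ with $t(u)=s(u)$ for all $u\in P_s$, and non-completable otherwise. For $P\subseteq P_s$, $s_P$ is the partial outmap with $s_P(u)=s(u)$ for $u\in P$ and $s_P(u)=*$ for $u\notin P$. A $k$-certificate is a partial outmap $s$ with $|P_s|=k$ that is non-completable and such that $s_P$ is completable for every proper subset $P\subsetneq P_s$. A dimension $i\in[n]$ is projectable if $s(u)_i=s(v)_i$ for all $u,v\in P_s$. A dimension $i$ is spanned if there are $u,v\in P_s$ with $u_i\ne v_i$; $P_s$ spans all dimensions if every $i\in[n]$ is spanned. Two partial outmaps are isomorphic if one is obtained from the other by an automorphism of the hypercube (a coordinate permutation composed with a translation $u\mapsto u\oplus a$), with the outmap values permuted accordingly. Flipping all edges in a subset of the dimensions replaces $s(u)$ by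 $s(u)\oplus z$ at all $u\in P_s$, where $z$ is the indicator bitstring of that subset. *)

(* Defs.v *)
From mathcomp Require Import all_boot all_fingroup.

Set Implicit Arguments.
Unset Strict Implicit.
Unset Printing Implicit Defensive.

(* Coordinates are numbered 0, ..., n-1, and the bitstring
   b_1 b_2 ... b_n is the tuple [tuple b_1; b_2; ...; b_n]. *)
Definition cube (n : nat) := n.-tuple bool.

Definition bxor n (u v : cube n) : cube n :=
  [tuple tnth u i (+) tnth v i | i < n].

Definition unit_bit n (i : 'I_n) : cube n := [tuple j == i | j < n].

(* tnth (t u) i = true means that the edge between u and u + e_i points away
   from u; t describes an orientation iff both endpoints of every edge agree
   on the direction of that edge. *)
Definition is_orientation n (t : cube n -> cube n) : Prop :=
  forall (u : cube n) (i : 'I_n),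
    tnth (t (bxor u (unit_bit i))) i = ~~ tnth (t u) i.

(* The face through v whose free dimensions are those in A. *)
Definition face n (v : cube n) (A : {set 'I_n}) : {set cube n} :=
  [set u | [forall i, (i \notin A) ==> (tnth u i == tnth v i)]].

Definition is_sink n (t : cube n -> cube n) (v : cube n) (A : {set 'I_n})
    (u : cube n) : Prop :=
  u \in face v A /\ forall i : 'I_n, i \in A -> tnth (t u) i = false.

Definition is_USO n (t : cube n -> cube n) : Prop :=
  is_orientation t /\
  forall (v : cube n) (A : {set 'I_n}), exists! u, is_sink t v A u.

(* None plays the role of the unknown value "*". *)
Definition partial_outmap (n : nat) := cube n -> option (cube n).

Definition known n (s : partial_outmap n) : {set cube n} :=
  [set u | s u != None].

Definition completable n (s : partial_outmap n) : Prop :=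
  exists2 t : cube n -> cube n,
    is_USO t & forall u, u \in known s -> s u = Some (t u).

Definition restrict n (s : partial_outmap n) (P : {set cube n}) :
    partial_outmap n :=
  fun u => if u \in P then s u else None.

Definition certificate (k n : nat) (s : partial_outmap n) : Prop :=
  [/\ #|known s| = k,
      ~ completable s &
      forall P : {set cube n}, P \proper known s -> completable (restrict s P)].

Definition projectable n (s : partial_outmap n) (i : 'I_n) : Prop :=
  forall u v x y : cube n,
    s u = Some x -> s v = Some y -> tnth x i = tnth y i.

Definition spanned n (s : partial_outmap n) (i : 'I_n) : Prop :=
  exists u v : cube n,
    [/\ u \in known s, v \in known s & tnth u i != tnth v i].

Definition permute_bits n (p : 'S_n) (u : cube n) : cube n :=
  [tuple tnth u (p i) | i < n].

(* s arises from r by the cube automorphism u |-> p(u) + a, followed by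
   flipping all edges in the dimensions indicated by z. *)
Definition isomorphic_up_to_flips n (r s : partial_outmap n) : Prop :=
  exists (p : 'S_n) (a z : cube n), forall u : cube n,
    s (bxor (permute_bits p u) a) =
    omap (fun x => bxor (permute_bits p x) z) (r u).

Definition outmap_a : partial_outmap 3 := fun u =>
  match tval u with
  | [:: true;  false; false] => Some [tuple true;  false; true]
  | [:: false; true;  false] => Some [tuple true;  true;  false]
  | [:: false; false; true]  => Some [tuple false; true;  true]
  | [:: true;  true;  true]  => Some [tuple false; false; false]
  | _ => None
  end.

Definition outmap_b : partial_outmap 3 := fun u =>
  match tval u with
  | [:: false; false; false] => Some [tuple false; true;  false]
  | [:: true;  false; false] => Some [tuple true;  false; true]
  | [:: false; true;  true]  => Some [tuple true;  true;  true]
  | [:: true;  true;  true]  => Some [tuple false; false; false]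
  | _ => None
  end.

(* Main.v *)
Require Import Defs.
From mathcomp Require Import all_boot all_fingroup.

(* A map t is a USO iff every two vertices u, v are covered by some dimension i,
   i.e. u_i <> v_i and t(u)_i <> t(v)_i (Szabo and Welzl). Fix a dimension i and
   let the phase of a known vertex u be u_i + s(u)_i; only pairs of equal phase
   are covered by i. Two USOs of the facets in direction i that coincide over a
   set W of base vertices can be glued with the i-edges over W oriented one way
   and all others the other way. Taking W to be the known vertices of phase c,
   one needs to complete, without dimension i, the known vertices of each facet
   together with those of phase c. Hence at most three pairwise covered vertices
   are always completable, and four are completable as soon as some i covers a
   pair of one phase while every pair of the other phase is covered by another
   dimension. So in a 4-certificate every dimension covers exactly two
   complementary pairs, and is the only one to cover them. The six pairs thus
   yield exactly three dimensions, and up to flips each of them is determined by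
   one bit; the eight cases are the two listed outmaps with relabelled points. *)

Set Implicit Arguments.
Unset Strict Implicit.
Unset Printing Implicit Defensive.

(** * Agreement and covering on a set of dimensions *)

Section Cube.

Variable n : nat.
Implicit Types (u v w x y z : cube n) (t g : cube n -> cube n).
Implicit Types (i j k : 'I_n) (A D : {set 'I_n}) (K : {set cube n}).

Lemma cubeP u v : (forall i, tnth u i = tnth v i) -> u = v.
Proof. exact: eq_from_tnth. Qed.

Lemma bxorE u v i : tnth (bxor u v) i = tnth u i (+) tnth v i.
Proof. by rewrite tnth_mktuple. Qed.

Lemma unit_bitE i j : tnth (unit_bit i) j = (j == i).
Proof. by rewrite tnth_mktuple. Qed.

Lemma permute_bitsE (p : 'S_n) u i : tnth (permute_bits p u) i = tnth u (p i).
Proof. by rewrite tnth_mktuple. Qed.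

Definition cov t i u v :=
  (tnth u i != tnth v i) && (tnth (t u) i != tnth (t v) i).

Definition agree D u v := [forall (i | i \in D), tnth u i == tnth v i].

Lemma agreeP D u v :
  reflect (forall i, i \in D -> tnth u i = tnth v i) (agree D u v).
Proof. exact: 'forall_in_eqP. Qed.

Lemma agree_refl D u : agree D u u.
Proof. exact/agreeP. Qed.

Lemma agree_sym D u v : agree D u v = agree D v u.
Proof. by apply/agreeP/agreeP => uv i /uv. Qed.

Lemma agree_trans D : transitive (agree D).
Proof.
by move=> v u w /agreeP uv /agreeP vw; apply/agreeP => i iD; rewrite uv ?vw.
Qed.

Lemma agreeT u v : agree setT u v = (u == v).
Proof.
apply/agreeP/eqP => [uv | -> //].
by apply: cubeP => i; apply: uv; rewrite inE.
Qed.

Lemma covC t i u v : cov t i u v = cov t i v u.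
Proof. by rewrite /cov eq_sym [tnth (t u) i == _]eq_sym. Qed.

Definition covered t D u v := [exists (i | i \in D), cov t i u v].

Lemma coveredP t D u v :
  reflect (exists2 i, i \in D & cov t i u v) (covered t D u v).
Proof. exact: exists_inP. Qed.

Lemma coveredC t D u v : covered t D u v = covered t D v u.
Proof.
by apply/coveredP/coveredP => -[i iD c]; exists i; rewrite // covC.
Qed.

Lemma covered_agree t D u v : covered t D u v -> ~~ agree D u v.
Proof.
case/coveredP=> i iD /andP[uv _].
by apply/agreeP => /(_ i iD)/eqP; apply/negP.
Qed.

Lemma covered_agreeE t g D u v : agree D (t u) (g u) -> agree D (t v) (g v) ->
  covered t D u v = covered g D u v.
Proof.
move=> /agreeP Eu /agreeP Ev; apply: eq_existsb => i.
by case: (boolP (i \in D)) => //= iD; rewrite /cov Eu ?Ev.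
Qed.

(* USOs of the cube with coordinate set D, as functions of the large cube whose
   arguments and values only matter on D. *)
Definition uso_on D g :=
  (forall u v, agree D u v -> agree D (g u) (g v)) /\
  (forall u v, ~~ agree D u v -> covered g D u v).

Definition completable_on D K t :=
  exists2 g, uso_on D g & {in K, forall u, agree D (t u) (g u)}.

Definition pairwise_covered D K t :=
  {in K &, forall u v, u != v -> covered t D u v}.

Definition phase t i u := tnth u i (+) tnth (t u) i.

Lemma cov_phase t i u v : cov t i u v -> phase t i u = phase t i v.
Proof.
by rewrite /cov /phase; do 4!case: (tnth _ i).
Qed.

Lemma covered_setD1 t D i u v :
  covered t D u v -> ~~ cov t i u v -> covered t (D :\ i) u v.
Proof.
case/coveredP=> j jD c nc; apply/coveredP; exists j => //.
by rewrite !inE jD andbT; apply: contraNneq nc => <-.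
Qed.

(** * Gluing two facet orientations along a dimension *)

Section Glue.

Variables (t g0 g1 : cube n -> cube n) (D : {set 'I_n}) (i : 'I_n).
Variables (K : {set cube n}) (c : bool).
Hypothesis iD : i \in D.
Let A := D :\ i.
Let flipped u := [exists (w | w \in K), (phase t i w == c) && agree A u w].

Hypotheses (uso0 : uso_on A g0) (uso1 : uso_on A g1).
(** Known vertices of phase [c] constrain both facets, even the one not containing them; this makes
    [g0] and [g1] coincide over [flipped]. *)
Hypothesis g0K : {in K, forall u,
  ~~ tnth u i || (phase t i u == c) -> agree A (t u) (g0 u)}.
Hypothesis g1K : {in K, forall u,
  tnth u i || (phase t i u == c) -> agree A (t u) (g1 u)}.
(** Keeps known vertices of the other phase away from [flipped], where their [i]-edge would get the
    wrong direction. *)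
Hypothesis sepK : {in K &, forall u v, phase t i u != phase t i v ->
  ~~ agree A u v}.

(** Bit [i] is chosen so that the phase is [c] over [flipped] and [~~ c] elsewhere. *)
Let glue u : cube n :=
  [tuple if j == i then tnth u i (+) (if flipped u then c else ~~ c)
         else tnth ((if tnth u i then g1 else g0) u) j | j < n].

Let glue_i u : tnth (glue u) i = tnth u i (+) (if flipped u then c else ~~ c).
Proof. by rewrite tnth_mktuple eqxx. Qed.

Let glue_A u : agree A (glue u) ((if tnth u i then g1 else g0) u).
Proof.
by apply/agreeP => j; rewrite !inE tnth_mktuple => /andP[/negPf->].
Qed.

Let agreeD u v : agree D u v = (tnth u i == tnth v i) && agree A u v.
Proof.
apply/agreeP/andP => [uv | [/eqP uvi /agreeP uv] j jD].
  split; first by rewrite uv.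
  by apply/agreeP => j; rewrite !inE => /andP[_ /uv].
by case: (eqVneq j i) => [-> // | ji]; apply: uv; rewrite !inE ji.
Qed.

Let flipped_agree u v : agree A u v -> flipped u = flipped v.
Proof.
move=> uv; apply: eq_existsb => w.
congr (_ && (_ && _)).
by apply/idP/idP; apply: agree_trans; rewrite // agree_sym.
Qed.

Let flipped_g u : flipped u -> agree A (g0 u) (g1 u).
Proof.
case/existsP=> w /andP[wK /andP[pw uw]].
apply: (agree_trans (uso0.1 _ _ uw)).
rewrite agree_sym; apply: (agree_trans (uso1.1 _ _ uw)).
have tg0 : agree A (t w) (g0 w) by apply: g0K; rewrite // pw orbT.
have tg1 : agree A (t w) (g1 w) by apply: g1K; rewrite // pw orbT.
by rewrite agree_sym in tg1; apply: agree_trans tg0.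
Qed.

Let sub_cov u v : covered glue A u v -> covered glue D u v.
Proof.
case/coveredP=> j; rewrite !inE => /andP[_ jD] cj.
by apply/coveredP; exists j.
Qed.

(* The two facets may be glued with the edges in dimension i reversed exactly
   over [flipped], because there the two facet orientations coincide. *)
Lemma glue_cross u v : ~~ tnth u i -> tnth v i -> covered glue D u v.
Proof.
move=> u0 v1.
have [fuv | fuv] := eqVneq (flipped u) (flipped v).
  apply/coveredP; exists i => //.
  by rewrite /cov !glue_i fuv v1 (negPf u0); case: ifP; case: (c).
apply: sub_cov.
have nuv : ~~ agree A u v by apply: contra_neqN fuv; exact: flipped_agree.
have Eu := glue_A u; have Ev := glue_A v.
rewrite (negPf u0) in Eu; rewrite v1 in Ev.
(* Exactly one of [u], [v] is flipped; [g0] and [g1] agree there, so both values can be read from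
   one facet USO. *)
case fu: (flipped u).
  rewrite (@covered_agreeE _ g1) //; first exact: uso1.2.
  exact: agree_trans (flipped_g fu).
have fv : flipped v by move: fuv; rewrite fu; case: (flipped v).
rewrite (@covered_agreeE _ g0) //; first exact: uso0.2.
by apply: agree_trans Ev _; rewrite agree_sym flipped_g.
Qed.

Lemma glue_uso : uso_on D glue.
Proof.
split=> u v.
  rewrite !agreeD => /andP[/eqP uvi uvA].
  rewrite !glue_i uvi (flipped_agree uvA) eqxx /=.
  apply: (agree_trans (glue_A u)); rewrite agree_sym.
  apply: (agree_trans (glue_A v)); rewrite agree_sym uvi.
  by case: (tnth v i); [apply: uso1.1 | apply: uso0.1].
case u1: (tnth u i); case v1: (tnth v i).
- rewrite agreeD u1 v1 /= => nuv; apply: sub_cov.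
  have Eu := glue_A u; have Ev := glue_A v; rewrite u1 in Eu; rewrite v1 in Ev.
  by rewrite (covered_agreeE Eu Ev) uso1.2.
- by move=> _; rewrite coveredC glue_cross // v1.
- by move=> _; rewrite glue_cross // u1.
- rewrite agreeD u1 v1 /= => nuv; apply: sub_cov.
  have Eu := glue_A u; have Ev := glue_A v; rewrite u1 in Eu; rewrite v1 in Ev.
  by rewrite (covered_agreeE Eu Ev) uso0.2.
Qed.

Lemma glue_extends : {in K, forall u, agree D (t u) (glue u)}.
Proof.
move=> u uK; rewrite agreeD glue_i.
have -> : flipped u = (phase t i u == c).
  apply/existsP/idP => [[w /andP[wK /andP[/eqP <- uw]]] | pu].
    by apply: contraTT uw => /sepK; apply.
  by exists u; rewrite uK pu agree_refl.
apply/andP; split.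
  by rewrite /phase; case: (tnth u i) (tnth _ i) (c) => [] [] [].
rewrite agree_sym; apply: (agree_trans (glue_A u)); rewrite agree_sym.
by case u1: (tnth u i); [apply: g1K | apply: g0K]; rewrite ?u1.
Qed.

Lemma glue_completable : completable_on D K t.
Proof. by exists glue; [exact: glue_uso | exact: glue_extends]. Qed.

End Glue.

(** * Completing at most four vertices *)

(** Gluing, with [c] the phase opposite to that of [x] and [y]. Each subproblem has the known
    vertices of one facet and those of phase [c]; it is proper since it loses [x] or [y], which lie
    in different facets. *)
Lemma completable_step t D i K x y :
  i \in D -> x \in K -> y \in K -> cov t i x y -> pairwise_covered D K t ->
  {in K &, forall x' y', phase t i x' != phase t i x ->
     cov t i x' y' -> covered t (D :\ i) x' y'} ->
  (forall K', K' \proper K -> pairwise_covered (D :\ i) K' t ->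
     completable_on (D :\ i) K' t) ->
  completable_on D K t.
Proof.
move=> iD xK yK cxy covK alt IH; pose c := ~~ phase t i x.
have alt' u v : u \in K -> v \in K -> u != v ->
    ~~ cov t i u v || (phase t i u == c) -> covered t (D :\ i) u v.
  move=> uK vK uv; case: (boolP (cov t i u v)) => [cuv /= pu | nc _].
    by apply: alt => //; rewrite (eqP pu) /c; case: (phase _ _ _).
  exact: covered_setD1 (covK _ _ uK vK uv) nc.
have facet b :
    completable_on (D :\ i) [set u in K | (tnth u i == b) || (phase t i u == c)] t.
  apply: IH.
    apply/properP; split; first by apply/subsetP => u; rewrite inE => /andP[].
    have [z zK [zb pz]] : exists2 z, z \in K & tnth z i != b /\ phase t i z != c.
      have px : phase t i x != c by rewrite /c; case: (phase _ _ _).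
      have py : phase t i y != c by rewrite -(cov_phase cxy).
      case: (eqVneq (tnth x i) b) => [xb | xb]; last by exists x.
      by exists y; rewrite // -xb eq_sym; case/andP: cxy.
    by exists z; rewrite // inE zK /= (negPf zb) (negPf pz).
  move=> u v; rewrite !inE => /andP[uK ub] /andP[vK vb] uv.
  apply: alt' => //; rewrite -implybE; apply/implyP => cuv.
  (* A pair covered by [i] has an end outside facet [b]; that end was kept for having phase [c], so
     both ends have it. *)
  have puv := cov_phase cuv; case/andP: cuv => + _.
  case/orP: ub => [/eqP -> | //]; rewrite puv.
  by case/orP: vb => [/eqP -> | //]; rewrite eqxx.
have [g0 uso0 g0K] := facet false; have [g1 uso1 g1K] := facet true.
apply: (@glue_completable t g0 g1 D i K c iD uso0 uso1).
- by move=> u uK ub; apply: g0K; rewrite inE uK eqbF_neg.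
- by move=> u uK ub; apply: g1K; rewrite inE uK eqb_id.
- move=> u v uK vK puv; apply: (@covered_agree t).
  apply: alt' => //; first by apply: contra_neq puv => ->.
  by apply/orP; left; apply: contra puv => /cov_phase ->.
Qed.

(** The maps [bxor z] are USOs, and [z] can be chosen to match the value at a single vertex. *)
Lemma completable_le1 t D K : #|K| <= 1 -> completable_on D K t.
Proof.
move=> K1.
suff xorP z : uso_on D (bxor z).
  case: (set_0Vmem K) => [-> | [w wK]].
    by exists (bxor [tuple false | _ < n]) => // u; rewrite inE.
  exists (bxor (bxor w (t w))) => // u uK.
  have -> : u = w by apply: (card_le1_eqP K1).
  by apply/agreeP => i _; rewrite !bxorE; case: (tnth w i) (tnth _ i) => [] [].
split=> u v.
  by move=> /agreeP uv; apply/agreeP => i /uv; rewrite !bxorE => ->.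
case/forall_inPn=> i iD uvi; apply/coveredP; exists i => //.
rewrite /cov uvi !bxorE /=.
by apply: contra_neq uvi => /addbI.
Qed.

(** Two pairs of different phases need four vertices, so the side condition of [completable_step]
    holds vacuously. *)
Lemma completable_le3 t D K : #|K| <= 3 -> pairwise_covered D K t ->
  completable_on D K t.
Proof.
have [m] := ubnP #|K|; elim: m K D => // m IH K D Km K3 covK.
have [/completable_le1 // | /card_gt1P[x [y [xK yK xy]]]] := leqP #|K| 1.
have /coveredP[i iD cxy] := covK _ _ xK yK xy.
apply: (completable_step iD xK yK cxy covK) => [x' y' x'K y'K px' cx'y' | K' ltK].
  have px := cov_phase cxy; have py' := cov_phase cx'y'.
  have x'y' : x' != y' by apply: contraTneq cx'y' => ->; rewrite /cov eqxx.
  have sub : uniq [:: x; y; x'; y'].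
    rewrite /= !inE !negb_or xy x'y' /= !andbT.
    by apply/and3P; split; [apply/andP; split | |];
      apply: contra_neq px' => ?; subst; congruence.
  suff : 4 <= #|K| by rewrite leqNgt ltnS K3.
  rewrite -[4]/(size [:: x; y; x'; y']) -(card_uniqP sub).
  apply: subset_leq_card; apply/subsetP => z; rewrite !inE.
  by case/or4P=> /eqP->.
have cK := proper_card ltK; apply: IH.
  exact: leq_trans cK _.
exact: leq_trans (ltnW cK) _.
Qed.

Lemma completable_four t D i K x y :
  #|K| = 4 -> i \in D -> x \in K -> y \in K -> cov t i x y ->
  pairwise_covered D K t ->
  {in K &, forall x' y', phase t i x' != phase t i x ->
     cov t i x' y' -> covered t (D :\ i) x' y'} ->
  completable_on D K t.
Proof.
move=> K4 iD xK yK cxy covK alt.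
apply: (completable_step iD xK yK cxy covK alt) => K' /proper_card.
by rewrite K4 ltnS; apply: completable_le3.
Qed.

(** * USOs as pairwise covered outmaps *)

(** On a face, covering makes the outmap on the free dimensions injective, hence bijective; the sink
    is the preimage of zero. *)
Lemma uso_on_is_USO t : uso_on setT t -> is_USO t.
Proof.
case=> _ covT.
have sep u v : u != v -> exists i, cov t i u v.
  by rewrite -agreeT => /covT/coveredP[i _ c]; exists i.
split=> [u i | v A].
  have /sep[j] : bxor u (unit_bit i) != u.
    apply/eqP => /(congr1 (fun x : cube n => tnth x i)).
    by rewrite /= bxorE unit_bitE eqxx; case: (tnth _ _).
  rewrite /cov bxorE unit_bitE => /andP[].
  case: (eqVneq j i) => [-> _ | _]; last by rewrite addbF eqxx.
  by do 2!case: (tnth _ _).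
(* Filling the fixed coordinates from [v] turns the outmap into a self-map of the face, so that
   injectivity gives surjectivity. *)
pose e u : cube n := [tuple if i \in A then tnth (t u) i else tnth v i | i < n].
have eE u i : tnth (e u) i = if i \in A then tnth (t u) i else tnth v i.
  by rewrite tnth_mktuple.
have faceP u :
    reflect (forall i, i \notin A -> tnth u i = tnth v i) (u \in face v A).
  rewrite inE; exact: 'forall_in_eqP.
have e_face : e @: face v A \subset face v A.
  by apply/subsetP => _ /imsetP[u _ ->]; apply/faceP => i /negPf iA; rewrite eE iA.
have e_inj : {in face v A &, injective e}.
  move=> u w /faceP uF /faceP wF ew; apply/eqP; apply: contraT => /sep[i /andP[uwi]].
  have iA : i \in A by apply: contraNT uwi => iA; rewrite uF ?wF.
  by have := congr1 (fun x => tnth x i) ew; rewrite /= !eE iA => ->; rewrite eqxx.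
have e_onto : e @: face v A = face v A.
  by apply/eqP; rewrite eqEcard e_face (card_in_imset e_inj) leqnn.
pose v0 : cube n := [tuple (i \notin A) && tnth v i | i < n].
have : v0 \in e @: face v A.
  by rewrite e_onto; apply/faceP => i iA; rewrite tnth_mktuple iA.
case/imsetP=> u uF v0E; exists u; split=> [|w [wF w0]].
  split=> // i iA; have := congr1 (fun x => tnth x i) v0E.
  by rewrite /= eE tnth_mktuple iA.
apply: e_inj => //; rewrite -v0E; apply: cubeP => i.
by rewrite eE tnth_mktuple; case: ifP => // /w0 ->.
Qed.

(** If [i] is free in a face, both facets in direction [i] have a sink. One is the sink of the whole
    face; reversing the [i]-edges promotes the other. *)
Lemma is_USO_flip1 t t' i : is_USO t ->
  (forall u j, tnth (t' u) j = tnth (t u) j (+) (j == i)) -> is_USO t'.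
Proof.
move=> [ort usot] t'E; split=> [u j | v A]; first by rewrite !t'E ort addNb.
have t'j j u : j != i -> tnth (t' u) j = tnth (t u) j.
  by move=> /negPf ji; rewrite t'E ji addbF.
case: (boolP (i \in A)) => iA; last first.
  have sinkE u : is_sink t' v A u <-> is_sink t v A u.
    by split=> -[uF u0]; split=> // j jA; have := u0 j jA;
      rewrite t'j //; apply: contraTneq jA => ->.
  have [u [/sinkE su uu]] := usot v A.
  by exists u; split=> // w /sinkE; apply: uu.
pose vb b : cube n := [tuple if j == i then b else tnth v j | j < n].
have faceE u : (u \in face v A) = (u \in face (vb (tnth u i)) (A :\ i)).
  rewrite !inE; apply: eq_forallb => j; rewrite !inE tnth_mktuple.
  by case: (eqVneq j i) => [-> | _] //=; rewrite iA eqxx.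
have sinkE s c u : (forall j w, j != i -> tnth (s w) j = tnth (t w) j) ->
    (forall w, tnth (s w) i = tnth (t w) i (+) c) ->
    is_sink s v A u <-> is_sink t (vb (tnth u i)) (A :\ i) u /\ tnth (t u) i = c.
  move=> sj si; rewrite /is_sink faceE; split=> [[uF u0] | [[uF u0] uc]].
    split; last by have := u0 i iA; rewrite si; case: (tnth _ _) (c) => [] [].
    by split=> // j /setD1P[ji /u0]; rewrite sj.
  split=> // j jA; case: (eqVneq j i) => [-> | ji]; first by rewrite si uc addbb.
  by rewrite sj // u0 // !inE ji.
have sinkt u : is_sink t v A u <->
    is_sink t (vb (tnth u i)) (A :\ i) u /\ tnth (t u) i = false.
  by apply: sinkE => // w; rewrite addbF.
have sinkt' u : is_sink t' v A u <->
    is_sink t (vb (tnth u i)) (A :\ i) u /\ tnth (t u) i = true.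
  by apply: sinkE => [j w | w]; [exact: t'j | rewrite t'E eqxx].
have vb_i b u : u \in face (vb b) (A :\ i) -> tnth u i = b.
  by rewrite inE => /forallP/(_ i); rewrite !inE tnth_mktuple eqxx => /eqP.
have [u [/sinkt[su tu] uu]] := usot v A.
have [w [sw uw]] := usot (vb (~~ tnth u i)) (A :\ i).
have wi : tnth w i = ~~ tnth u i by apply: vb_i sw.1.
have tw : tnth (t w) i = true.
  case tw: (tnth _ _) => //.
  have /uu uw' : is_sink t v A w by apply/sinkt; rewrite wi.
  by move: wi; rewrite uw'; case: (tnth _ _).
exists w; split=> [|x /sinkt'[sx tx]]; first by apply/sinkt'; rewrite wi.
have [xi | xi] := eqVneq (tnth x i) (tnth u i); last first.
  by apply: uw; move: sx; have -> : tnth x i = ~~ tnth u i by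
    case: (tnth x i) (tnth u i) xi => [] [].
have [y [_ uy]] := usot (vb (tnth u i)) (A :\ i).
rewrite xi in sx; move: tu tx.
by rewrite -(uy u su) -(uy x sx) => ->.
Qed.

Lemma is_USO_flip t (Z : {set 'I_n}) : is_USO t ->
  is_USO (fun u => [tuple tnth (t u) i (+) (i \in Z) | i < n]).
Proof.
move=> usot; have [m] := ubnP #|Z|; elim: m Z => // m IH Z Zm.
case: (set_0Vmem Z) => [-> | [i iZ]].
  have [ort sinkt] := usot; split=> [u i | v A].
    by rewrite !tnth_mktuple !inE !addbF ort.
  have [u [[uF u0] uu]] := sinkt v A; exists u.
  split=> [|w [wF w0]]; first by split=> // i /u0; rewrite tnth_mktuple inE addbF.
  by apply: uu; split=> // i /w0; rewrite tnth_mktuple inE addbF.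
have ltZ : #|Z :\ i| < m by rewrite -ltnS (leq_trans _ Zm) // (cardsD1 i Z) iZ.
apply: (is_USO_flip1 (i := i) (IH _ ltZ)) => u j; rewrite !tnth_mktuple !inE.
by case: (eqVneq j i) => [-> | _]; rewrite ?iZ ?addbF.
Qed.

(** Flip the dimensions outgoing at [u], making [u] a sink. Without a covering dimension, [v] would
    be a second sink of the smallest face containing both. *)
Lemma is_USO_covered t u v : is_USO t -> u != v -> covered t setT u v.
Proof.
move=> usot uv; apply: contraT => ncov.
pose A := [set i | tnth u i != tnth v i].
have [_ sinkt] := is_USO_flip [set i | tnth (t u) i] usot.
have [w [_ uw]] := sinkt u A.
have wu : w = u.
  apply: uw; split=> [|i _]; first by rewrite inE; apply/forall_inP.
  by rewrite tnth_mktuple inE addbb.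
rewrite -wu in uv; apply: contra_neqT uv => _; apply: uw; split=> [|i].
  by rewrite inE; apply/forall_inP => i; rewrite inE negbK eq_sym.
rewrite inE tnth_mktuple inE => uvi; apply/eqP.
by apply: contraNT ncov => tuv; apply/coveredP; exists i; rewrite // /cov uvi;
  case: (tnth _ _) (tnth _ _) tuv => [] [].
Qed.

(** * Covering structure of four non-completable vertices *)

Section FourPoints.

Variables (K : {set cube n}) (t : cube n -> cube n).
Hypotheses (K4 : #|K| = 4) (covK : pairwise_covered setT K t).
Hypothesis not_completable : ~ completable_on setT K t.

Definition labels a b c d := perm_eq [:: a; b; c; d] (enum K).

Lemma labels_swap a b c d : labels a b c d -> labels c d a b.
Proof.
by apply: perm_trans; apply/seq.permP => P /=; do 4!case: (P _).
Qed.

(** Fixes [a] and cycles through the three splittings of the points into two pairs. *)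
Lemma labels_rot a b c d : labels a b c d -> labels a c d b.
Proof.
by apply: perm_trans; apply/seq.permP => P /=; do 4!case: (P _).
Qed.

Lemma labels_mem a b c d x : labels a b c d -> (x \in K) = (x \in [:: a; b; c; d]).
Proof. by move/perm_mem->; rewrite mem_enum. Qed.

Lemma labels_exist : exists a b c d, labels a b c d.
Proof.
have : size (enum K) = 4 by rewrite -cardE.
rewrite /labels; case: (enum K) => [|a [|b [|c [|d []]]]] // _.
by exists a, b, c, d.
Qed.

(* Otherwise [completable_four] would apply in dimension [i]. *)
Lemma cov_complement a b c d i : labels a b c d -> cov t i a b ->
  [/\ cov t i c d, phase t i c != phase t i a & forall j, cov t j c d -> j = i].
Proof.
move=> lab cab.
have [/existsP[x /existsP[y /and5P[xK yK px cxy ncxy]]] | none] := boolP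
    [exists x, exists y, [&& x \in K, y \in K, phase t i x != phase t i a,
      cov t i x y & ~~ covered t (setT :\ i) x y]]; last first.
  case: not_completable.
  apply: (completable_four K4 (in_setT i) _ _ cab covK);
    rewrite ?(labels_mem _ lab) ?inE ?eqxx ?orbT //.
  move=> x y xK yK px cxy; apply: contraR none => ncxy.
  by apply/existsP; exists x; apply/existsP; exists y; rewrite xK yK px cxy.
have xy : x != y by apply: contraTneq cxy => ->; rewrite /cov eqxx.
have py := cov_phase cxy; have pab := cov_phase cab.
have out z : z \in K -> phase t i z != phase t i a -> (z == c) || (z == d).
  rewrite (labels_mem _ lab) !inE => /or4P[] /eqP->; rewrite ?eqxx ?orbT //.
  by rewrite pab eqxx.
have only j : cov t j x y -> j = i.
  move=> cj; apply: contraNeq ncxy => ji.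
  by apply/coveredP; exists j; rewrite // !inE ji.
have outx := out x xK px; have := out y yK; rewrite -py => /(_ px) outy.
case/orP: outx outy xy cxy px only {py} => /eqP-> /orP[] /eqP->;
  rewrite ?eqxx // => _ cxy px only.
split=> [||j]; first by rewrite covC.
  by rewrite -(cov_phase cxy).
by rewrite covC; apply: only.
Qed.

(** Both pairs are covered by [i] and their phases differ, so relative to [a] the single bit [e]
    determines everything in dimension [i]. *)
Lemma cov_bits a b c d i : labels a b c d -> cov t i a b ->
  let e := tnth c i (+) tnth a i in
  [/\ tnth b i (+) tnth a i, tnth d i (+) tnth a i = ~~ e,
      tnth (t b) i (+) tnth (t a) i, tnth (t c) i (+) tnth (t a) i = ~~ e
    & tnth (t d) i (+) tnth (t a) i = e].
Proof.
move=> lab cab /=; have [ccd pca _] := cov_complement lab cab.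
move: cab ccd pca; rewrite /cov /phase.
by do 8!case: (tnth _ i).
Qed.

Lemma cov_only a b c d i j : labels a b c d -> cov t i a b -> cov t j a b -> j = i.
Proof.
move=> lab cab; have [ccd _ _] := cov_complement lab cab.
by have [_ _] := cov_complement (labels_swap lab) ccd; apply.
Qed.

Lemma cov_disjoint a b c d i : labels a b c d -> cov t i a b -> ~~ cov t i a c.
Proof.
move=> lab cab; have [_ + _] := cov_complement lab cab.
by apply: contraNN => /cov_phase ->.
Qed.

(** Otherwise [i] covers no pair at all, since covered pairs come with their complements; then the
    points or their values are constant in dimension [i]. *)
Lemma some_cov a b c d i : labels a b c d ->
  (exists x y, [/\ x \in K, y \in K & tnth x i != tnth y i]) ->
  (exists x y, [/\ x \in K, y \in K & tnth (t x) i != tnth (t y) i]) ->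
  [|| cov t i a b, cov t i a c | cov t i a d].
Proof.
move=> lab [x [y [xK yK xy]]] [x' [y' [x'K y'K tx'y']]]; apply: contraT => no_cov.
have lab' := labels_rot lab; have lab'' := labels_rot lab'.
have ncd : ~~ cov t i c d.
  by apply: contraNN no_cov => /(cov_complement (labels_swap lab))[-> _ _].
have ndb : ~~ cov t i d b.
  by apply: contraNN no_cov => /(cov_complement (labels_swap lab'))[-> _ _];
    rewrite orbT.
have nbc : ~~ cov t i b c.
  by apply: contraNN no_cov => /(cov_complement (labels_swap lab''))[-> _ _];
    rewrite !orbT.
have u_abcd : ~~ [&& tnth b i == tnth a i, tnth c i == tnth a i
                   & tnth d i == tnth a i].
  apply: contraNN xy => /and3P[/eqP ub /eqP uc /eqP ud].
  have const z : z \in K -> tnth z i = tnth a i.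
    by rewrite (labels_mem _ lab) !inE => /or4P[] /eqP->.
  by rewrite !const.
have t_abcd : ~~ [&& tnth (t b) i == tnth (t a) i, tnth (t c) i == tnth (t a) i
                   & tnth (t d) i == tnth (t a) i].
  apply: contraNN tx'y' => /and3P[/eqP ub /eqP uc /eqP ud].
  have const z : z \in K -> tnth (t z) i = tnth (t a) i.
    by rewrite (labels_mem _ lab) !inE => /or4P[] /eqP->.
  by rewrite !const.
move: no_cov ncd ndb nbc u_abcd t_abcd; rewrite /cov.
by do 8!case: (tnth _ i).
Qed.

End FourPoints.

End Cube.

(** * Frames and the two explicit outmaps *)

(* The bits of the four points (or, with [~~ b] for [b], of their values) in the
   [k]-th dimension, relative to point 0, when that dimension covers the pair
   {0, k + 1} and its complement. *)
Definition pattern (b : bool) (k : nat) : seq bool :=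
  false :: rotr k [:: true; b; ~~ b].

Definition value n (s : partial_outmap n) (u : cube n) : cube n := odflt u (s u).

Lemma known_value n (s : partial_outmap n) u :
  u \in known s -> s u = Some (value s u).
Proof. by rewrite inE /value; case: (s u). Qed.

(** Bits relative to point 0 are insensitive to translations and flips, so [b] determines [s] up to
    isomorphism and flips. *)
Record frame (s : partial_outmap 3) (P : 'I_4 -> cube 3) (d : 'I_3 -> 'I_3)
    (b : nat -> bool) : Prop := Frame {
  frame_inj : injective d;
  frame_known : forall u, u \in known s <-> exists j, u = P j;
  frame_point : forall k j,
    tnth (P j) (d k) (+) tnth (P ord0) (d k) = nth false (pattern (b k) k) j;
  frame_value : forall k j,
    tnth (value s (P j)) (d k) (+) tnth (value s (P ord0)) (d k)
      = nth false (pattern (~~ b k) k) j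
}.

Lemma iso_of_frames r s R P m d b :
  frame r R m b -> frame s P d b -> isomorphic_up_to_flips r s.
Proof.
case=> m_inj rR Rm rRm [d_inj sP Pd sPd].
(* [permute_bits p] reads bit [p i] into position [i], so [p] must send [d k] to [m k]. *)
pose p := ((perm d_inj)^-1 * perm m_inj)%g.
have pd k : p (d k) = m k by rewrite permM -[d k](permE d_inj) permK permE.
have d_onto i : exists k, i = d k.
  by exists ((perm d_inj)^-1%g i); rewrite -(permE d_inj) permKV.
pose a := bxor (permute_bits p (R ord0)) (P ord0).
pose z := bxor (permute_bits p (value r (R ord0))) (value s (P ord0)).
have PR j : bxor (permute_bits p (R j)) a = P j.
  apply: cubeP => i; have [k ->] := d_onto i.
  by rewrite !(bxorE, permute_bitsE) pd addbA Rm -Pd addbK.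
exists p, a, z => u; case ru: (r u) => [x|] /=.
  have /rR[j uj] : u \in known r by rewrite inE ru.
  rewrite uj PR known_value; last by apply/sP; exists j.
  congr Some; apply: cubeP => i; have [k ->] := d_onto i.
  have -> : x = value r (R j) by rewrite -uj /value ru.
  by rewrite !(bxorE, permute_bitsE) pd addbA rRm -sPd addbK.
apply/eqP; apply: contraT => su.
have /sP[j uj] : bxor (permute_bits p u) a \in known s by rewrite inE.
have /rR : exists j, u = R j.
  exists j; apply: cubeP => i; have := congr1 (fun x => tnth x (p^-1%g i)) uj.
  by rewrite -PR !(bxorE, permute_bitsE) permKV => /addIb.
by rewrite inE ru.
Qed.

Definition vertex (x y z : bool) : cube 3 := [tuple x; y; z].

Lemma cube3P (P : cube 3 -> Prop) :
  (forall x y z, P (vertex x y z)) -> forall u, P u.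
Proof.
move=> Pv u; case/tupleP: u => x u; case/tupleP: u => y u; case/tupleP: u => z u.
by have := Pv x y z; congr P; rewrite (tuple0 u); apply: val_inj.
Qed.

Definition column (ws : seq (cube 3)) (i : nat) : seq bool :=
  let w0 := head (vertex false false false) ws in
  [seq nth false w i (+) nth false w0 i | w : cube 3 <- ws].

(** A boolean form of [frame], so that concrete cases are settled by evaluation. *)
Definition frame_table (r : partial_outmap 3) (R : seq (cube 3)) (m : seq nat)
    (b : nat -> bool) : bool :=
  [&& size R == 4, perm_eq m (iota 0 3) &
      all (fun k => (column R (nth 0 m k) == pattern (b k) k) &&
        (column (map (value r) R) (nth 0 m k) == pattern (~~ b k) k)) (iota 0 3)].

Lemma frame_of_table r R m b : known r =i R -> frame_table r R m b ->
  exists P d, frame r P d b.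
Proof.
move=> rR /and3P[/eqP R4 m3 /allP tabP]; set v0 := vertex false false false.
have sm : size m = 3 by rewrite (perm_size m3).
have um : uniq m by rewrite (perm_uniq m3) iota_uniq.
have m_lt k : k < 3 -> nth 0 m k < 3.
  move=> k3; have := mem_nth 0 (n := k) (s := m).
  by rewrite sm (perm_mem m3) mem_iota; apply.
have columnE ws (k : 'I_3) (j : 'I_4) : size ws = 4 ->
    tnth (nth v0 ws j) (inord (nth 0 m k)) (+) tnth (nth v0 ws 0) (inord (nth 0 m k))
      = nth false (column ws (nth 0 m k)) j.
  move=> w4; rewrite (nth_map v0) ?w4 // nth0.
  by rewrite !(tnth_nth false) inordK // m_lt.
have tab (k : 'I_3) : column R (nth 0 m k) = pattern (b k) k /\
    column (map (value r) R) (nth 0 m k) = pattern (~~ b k) k.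
  by have /tabP/andP[/eqP ? /eqP ?] : (k : nat) \in iota 0 3 by rewrite mem_iota /=.
exists (fun j => nth v0 R j), (fun k => inord (nth 0 m k)); split.
- move=> k l /(congr1 val); rewrite /= !inordK ?m_lt // => /eqP.
  by rewrite nth_uniq ?sm // => /eqP/val_inj.
- move=> u; rewrite rR; split=> [/(nthP v0)[j] | [j ->]].
    by rewrite R4 => j4 <-; exists (Ordinal j4).
  by rewrite mem_nth ?R4.
- by move=> k j; rewrite columnE // (tab k).1.
- move=> k j; rewrite -(tab k).2 -columnE ?size_map //.
  by rewrite !(nth_map v0) ?R4.
Qed.

(** The two constant triples [b 0], [b 1], [b 2] are realised by [outmap_a], the other six by
    [outmap_b]. *)
Lemma outmap_frames (b : nat -> bool) :
  exists R m, frame outmap_a R m b \/ frame outmap_b R m b.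
Proof.
pose v := vertex.
pose A := [:: v true false false; v false true false; v false false true;
  v true true true].
pose B := [:: v false false false; v true false false; v false true true;
  v true true true].
have fA R m : perm_eq R A -> frame_table outmap_a R m b ->
    exists R m, frame outmap_a R m b \/ frame outmap_b R m b.
  move=> /perm_mem RA /frame_of_table[].
    by apply: cube3P => x y z; rewrite RA inE; case: x y z => [] [] [].
  by move=> P [d fr]; exists P, d; left.
have fB R m : perm_eq R B -> frame_table outmap_b R m b ->
    exists R m, frame outmap_a R m b \/ frame outmap_b R m b.
  move=> /perm_mem RB /frame_of_table[].
    by apply: cube3P => x y z; rewrite RB inE; case: x y z => [] [] [].
  by move=> P [d fr]; exists P, d; right.
pose ia m := [seq nth (v false false false) A i | i <- m].
pose ib m := [seq nth (v false false false) B i | i <- m].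
case b0: (b 0); case b1: (b 1); case b2: (b 2);
  (* The first list orders the known vertices; entry [k] of the second is the dimension covering
     points 0 and [k + 1]. *)
  [ apply: (fA (ia [:: 0; 1; 3; 2]) [:: 1; 2; 0])
  | apply: (fB (ib [:: 0; 1; 3; 2]) [:: 0; 1; 2])
  | apply: (fB (ib [:: 0; 3; 2; 1]) [:: 1; 2; 0])
  | apply: (fB (ib [:: 0; 2; 3; 1]) [:: 2; 1; 0])
  | apply: (fB (ib [:: 0; 2; 1; 3]) [:: 2; 0; 1])
  | apply: (fB (ib [:: 0; 1; 2; 3]) [:: 0; 2; 1])
  | apply: (fB (ib [:: 0; 3; 1; 2]) [:: 1; 0; 2])
  | apply: (fA (ia [:: 0; 1; 2; 3]) [:: 1; 0; 2]) ] => //;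
  by rewrite /frame_table /= b0 b1 b2.
Qed.

(** * From certificates to frames *)

Section Certificate.

Variables (n : nat) (s : partial_outmap n).
Hypothesis cert_s : certificate 4 s.

Let K4 : #|known s| = 4. Proof. by case: cert_s. Qed.

(** Two of the four vertices form a proper subset, so a USO extends their values and covers the
    pair. *)
Lemma certificate_covered : pairwise_covered setT (known s) (value s).
Proof.
move=> u v uK vK uv; have [_ _ /(_ [set u; v])] := cert_s.
case.
  have sub : [set u; v] \subset known s by apply/subsetP => w /set2P[] ->.
  by rewrite properEcard sub K4 cards2 uv.
move=> t usot tE; have := is_USO_covered usot uv.
have valueE w : w \in [set u; v] -> w \in known s -> value s w = t w.
  move=> wuv wK; have := tE w; rewrite inE /restrict wuv -/(known s).
  by rewrite known_value // => /(_ isT)[].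
by rewrite (@covered_agreeE _ t (value s)) // -valueE ?agree_refl // !inE eqxx ?orbT.
Qed.

Lemma certificate_not_completable : ~ completable_on setT (known s) (value s).
Proof.
case=> t /uso_on_is_USO usot tE; have [_ + _] := cert_s; case.
exists t => // u uK; rewrite known_value //; congr Some.
by apply/eqP; rewrite -agreeT tE.
Qed.

End Certificate.

Theorem theorem61 (n : nat) (s : partial_outmap n)
    (cert_s : certificate 4 s)
    (no_proj : forall i : 'I_n, ~ projectable s i)
    (span_all : forall i : 'I_n, spanned s i) :
  exists n3 : n = 3,
    let s3 : partial_outmap 3 := ecast m (partial_outmap m) n3 s in
    isomorphic_up_to_flips outmap_a s3 \/ isomorphic_up_to_flips outmap_b s3.
Proof.
have [K4 _ _] := cert_s.
have covK := certificate_covered cert_s.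
have ncomp := certificate_not_completable cert_s.
have [p0 [p1 [p2 [p3 lab]]]] := labels_exist K4.
have lab' := labels_rot lab; have lab'' := labels_rot lab'.
have memK x := labels_mem x lab.
have : uniq [:: p0; p1; p2; p3] by rewrite (perm_uniq lab) enum_uniq.
rewrite /= !inE !negb_or andbT => /and3P[/and3P[p01 p02 p03] _ _].
have dim x : x \in known s -> p0 != x -> exists i, cov (value s) i p0 x.
  move=> xK p0x; have p0K : p0 \in known s by rewrite memK mem_head.
  by have /coveredP[i _ c] := covK _ _ p0K xK p0x; exists i.
have [d1 c1] : exists i, cov (value s) i p0 p1.
  by apply: dim; rewrite // memK !inE eqxx ?orbT.
have [d2 c2] : exists i, cov (value s) i p0 p2.
  by apply: dim; rewrite // memK !inE eqxx ?orbT.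
have [d3 c3] : exists i, cov (value s) i p0 p3.
  by apply: dim; rewrite // memK !inE eqxx ?orbT.
(* Each dimension covers some pair containing [p0], and each such pair has only one covering
   dimension. *)
have d_onto i : i \in [:: d1; d2; d3].
  have : [|| cov (value s) i p0 p1, cov (value s) i p0 p2 | cov (value s) i p0 p3].
    apply: (some_cov K4 covK ncomp lab).
      by have [x [y [xK yK xy]]] := span_all i; exists x, y.
    have [/exists_inP[x xK /exists_inP[y yK xy]] | const] := boolP
        [exists x in known s, exists y in known s,
          tnth (value s x) i != tnth (value s y) i].
      by exists x, y.
    case: (no_proj i) => u v x y su sv; apply: contraNeq const => xy.
    apply/exists_inP; exists u; first by rewrite inE su.
    apply/exists_inP; exists v; first by rewrite inE sv.
    by rewrite /value su sv.
  rewrite !inE => /or3P[c | c | c].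
  - by rewrite (cov_only K4 covK ncomp lab c1 c) eqxx.
  - by rewrite (cov_only K4 covK ncomp lab' c2 c) eqxx orbT.
  - by rewrite (cov_only K4 covK ncomp lab'' c3 c) eqxx !orbT.
have d_uniq : uniq [:: d1; d2; d3].
  rewrite /= !inE negb_or !andbT -andbA; apply/and3P; split.
  - by apply: contraTneq c2 => <-; apply: (cov_disjoint K4 covK ncomp lab).
  - by apply: contraTneq c1 => ->; apply: (cov_disjoint K4 covK ncomp lab'').
  - by apply: contraTneq c3 => <-; apply: (cov_disjoint K4 covK ncomp lab').
have n3 : n = 3.
  rewrite -[LHS]card_ord -[RHS]/(size [:: d1; d2; d3]) -(card_uniqP d_uniq).
  by apply: eq_card => i; rewrite d_onto.
have [U1 U1' T1 T1' T1''] := cov_bits K4 covK ncomp lab c1.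
have [U2 U2' T2 T2' T2''] := cov_bits K4 covK ncomp lab' c2.
have [U3 U3' T3 T3' T3''] := cov_bits K4 covK ncomp lab'' c3.
subst n; exists erefl => /=.
(* The bit [e] of [cov_bits] is read at the third label of [lab], [lab'], [lab''], which is [p2],
   [p3], [p1] in turn. *)
pose b := nth false [:: tnth p2 d1 (+) tnth p0 d1; tnth p3 d2 (+) tnth p0 d2;
                        tnth p1 d3 (+) tnth p0 d3].
have fr : frame s (fun j => nth p0 [:: p0; p1; p2; p3] j)
                  (fun k => nth d1 [:: d1; d2; d3] k) b.
  split.
  - by move=> k l /eqP; rewrite nth_uniq // => /eqP/val_inj.
  - move=> u; rewrite memK; split=> [/(nthP p0)[j j4 <-] | [j ->]].
      by exists (Ordinal j4).
    by rewrite mem_nth.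
  - by move=> [[|[|[|k]]] kP] [[|[|[|[|j]]]] jP]; rewrite //= ?addbb.
  - by move=> [[|[|[|k]]] kP] [[|[|[|[|j]]]] jP]; rewrite //= ?addbb ?negbK.
have [R [m [frR | frR]]] := outmap_frames b; [left | right];
  exact: iso_of_frames frR fr.
Qed.
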